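(* Let $X$ be a nonempty finite or countably infinite set and let $\alpha=(\alpha_{xy})_{x,y\in X}$ be a matrix with nonnegative real entries. Let $\Lambda\subseteq X$, and let $c\ge0$ and $w\ge0$ be (real-valued) vectors indexed by $X$ satisfying $$\sum_{k=0}^\infty c(I_\Lambda\alpha I_\Lambda)^kw<\infty .$$ If $(f_n)_{n\ge1}$ are functions $X\to[0,1]$, supported in $\Lambda$ and satisfying $\sum_nf_n=+\infty$ everywhere on $\Lambda$, then $$\lim_{n\to\infty}c\,\beta_{f_1}\cdots\beta_{f_n}I_\Lambda w=0 .$$ More generally, if $(\omega_n)_{n\ge1}$ are nonnegative clouds carried by $\Lambda$ that satisfy $|||\omega_n|||\le1$ and $\sum_n[1-\omega_n((x))]=+\infty$ for all $x\in\Lambda$, then $$\lim_{n\to\infty}c\,T_{\omega_1}\cdots T_{\omega_n}I_\Lambda w=0 .$$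
   Context: $c$ is a row vector and $w$ a column vector; all products and sums of nonnegative quantities are computed in $[0,+\infty]$ with $0\cdot\infty=0$. For $f\colon X\to\mathbb R$, $I_f$ is the diagonal matrix $(I_f)_{xy}=f(x)\delta_{xy}$; $I_\Lambda=I_{\chi_\Lambda}$ with $\chi_\Lambda$ the indicator function of $\Lambda$. A $0$-th power of a matrix is the identity. For $f\colon X\to[0,1]$ the cleaning operator is $\beta_f=I_{1-f}+I_f\alpha$. No subinvariance condition (such as $\alpha w\le w$) is assumed. A marker is a nonempty finite sequence $\eta=(x_0,\ldots,x_k)$ of elements of $X$. An ancestor of $\eta$ is any prefix $(x_0,\ldots,x_j)$, $0\le j\le k$; write $\sigma\preccurlyeq\eta$. A cloud is a real-valued function $\nu$ on the set of all markers. Put $|||\nu|||=\sup_\eta\sum_{\sigma\preccurlyeq\eta}|\nu(\sigma)|$. $\nu$ is carried by $\Lambda$ if $\nu(\eta)=0$ for every marker $\eta=(x_0,\ldots,x_k)$ having at least one index $j<k$ with $x_j\notin\Lambda$. For a nonnegative cloud $\nu$, $T_\nu$ is the matrix $(T_\nu)_{xy}=\sum\nu(\eta)\,\alpha_{x_0x_1}\cdots\alpha_{x_{k-1}x_k}\in[0,+\infty]$, summed over markers $\eta=(x_0,\ldots,x_k)$, $k\ge0$, with $x_0=x$, $x_k=y$ (empty product $=1$). *)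

(* Defs.v *)
From HB Require Import structures.
From mathcomp Require Import all_boot all_order all_algebra.
From mathcomp Require Import all_classical all_reals all_analysis.

Set Implicit Arguments.
Unset Strict Implicit.
Unset Printing Implicit Defensive.

Import Order.TTheory GRing.Theory Num.Theory.
Import numFieldNormedType.Exports.

Local Open Scope classical_set_scope.
Local Open Scope ring_scope.
Local Open Scope ereal_scope.

(* Matrices and vectors indexed by X are functions into \bar R, where           *)
(* 0 * +oo = 0. The sums are unordered ([esum]), hence meaningful only for      *)
(* nonnegative entries, which is the only case used.                            *)
Section ExtendedMatrices.
Context {R : realType} {X : countType}.
Implicit Types (A B : X -> X -> \bar R) (u v : X -> \bar R).

Definition emx_of (a : X -> X -> R) : X -> X -> \bar R := fun x y => (a x y)%:E.

Definition ediag (f : X -> R) : X -> X -> \bar R :=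
  fun x y => if x == y then (f x)%:E else 0.

Definition emx1 : X -> X -> \bar R := ediag (fun=> 1%R).

Definition emxadd A B : X -> X -> \bar R := fun x y => A x y + B x y.

Definition emxmul A B : X -> X -> \bar R :=
  fun x y => \esum_(z in [set: X]) (A x z * B z y).

Definition emxpow A (k : nat) : X -> X -> \bar R := iter k (emxmul A) emx1.

(* [emxprod A n] is the ordered product A 0 * A 1 * ... * A n.-1. *)
Definition emxprod (A : nat -> X -> X -> \bar R) (n : nat) : X -> X -> \bar R :=
  \big[emxmul/emx1]_(0 <= i < n) A i.

Definition erowmul u A : X -> \bar R :=
  fun y => \esum_(x in [set: X]) (u x * A x y).

Definition edot u v : \bar R := \esum_(x in [set: X]) (u x * v x).

Definition esandwich (c : X -> R) A (w : X -> R) : \bar R :=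
  edot (erowmul (EFin \o c) A) (EFin \o w).

Definition eproj (L : set X) : X -> X -> \bar R := ediag \1_L.

Definition cleaning (a : X -> X -> R) (f : X -> R) : X -> X -> \bar R :=
  emxadd (ediag (fun x => 1 - f x)%R) (emxmul (ediag f) (emx_of a)).

End ExtendedMatrices.

(* The pair (x_0, [:: x_1; ...; x_k]) encodes the marker (x_0, ..., x_k). *)
Definition marker (X : countType) : Type := (X * seq X)%type.

Section Clouds.
Context {R : realType} {X : countType}.
Implicit Types (eta : marker X) (nu : marker X -> R).

Definition mlen eta : nat := size eta.2.

(* Meaningful for j <= mlen eta. *)
Definition mnth eta (j : nat) : X := nth eta.1 (eta.1 :: eta.2) j.

Definition ancestor eta (j : nat) : marker X := (eta.1, take j eta.2).

(* The ancestors [ancestor eta j], j <= mlen eta, are pairwise distinct. *)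
Definition cloud_norm nu : \bar R :=
  ereal_sup (range (fun eta : marker X =>
    (\sum_(j < (mlen eta).+1) `|nu (ancestor eta j)|)%R%:E)).

Definition carried_by nu (L : set X) : Prop :=
  forall eta, (exists2 j, (j < mlen eta)%N & ~ L (mnth eta j)) -> nu eta = 0%R.

Definition mweight (a : X -> X -> R) eta : R :=
  (\prod_(j < mlen eta) a (mnth eta j) (mnth eta j.+1))%R.

Definition cloudmx (a : X -> X -> R) nu : X -> X -> \bar R :=
  fun x y =>
    \esum_(eta in [set eta : X * seq X |
                     mnth eta 0 = x /\ mnth eta (mlen eta) = y])
      (nu eta * mweight a eta)%:E.

End Clouds.

(* Main.v *)
Require Import Defs.
From HB Require Import structures.
From mathcomp Require Import all_boot all_order all_algebra.
From mathcomp Require Import all_classical all_reals all_analysis.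
From mathcomp Require Import lra.

Import Order.TTheory GRing.Theory Num.Theory.
Import numFieldNormedType.Exports.

Local Open Scope classical_set_scope.
Local Open Scope ring_scope.
Local Open Scope ereal_scope.

(** Clouds form a monoid under convolution along markers,
      (mu * nu)(x_0..x_k) = sum over j of mu(x_0..x_j) nu(x_j..x_k),
    and nu |-> T_nu turns convolution into matrix product ([cloudmx_mul]): a
    walk from x to y followed by a walk from y to z is a walk from x to z with
    a marked step.  The matrices I_f and alpha, hence the cleaning operators
    and I_L alpha I_L, are themselves of the form T_nu.  With
    P_n = omega_1 * ... * omega_n the quantity in the theorem is therefore a
    single sum over markers,
      sum over eta of P_n(eta) 1_L(x_k) c(x_0) alpha(eta) w(x_k),
    and it tends to 0 by dominated convergence ([esum_dominated_cvg0]).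

    Domination.  A factor omega_i carried by L only lets a walk leave from
    points of L, so a marker ending in L contributes only if it lies inside L
    ([carried_in_cprod]).  As P_n <= 1 ([cprod_le1]), the terms are bounded by
    the weights of the markers inside L, and grouping those by length gives at
    most sum_k c (I_L alpha I_L)^k w, which is finite ([esum_inside_fin]).

    Pointwise convergence ([cprod_cvg0]).  Let 1 be the constant cloud and
    S_n = P_n * 1, so that S_n(eta) is the sum of P_n over the ancestors of eta.
    The norm bound says omega_n * 1 <= 1, and by associativity
    S_(n+1) = P_n * (omega_(n+1) * 1) <= S_n; keeping only the term of eta
    itself in the difference gives
      P_n(eta) (1 - omega_(n+1)((x_k))) <= S_n(eta) - S_(n+1)(eta).
    Summing over n, the left-hand sides have total at most S_0(eta) = 1.  By
    induction on the length of eta, S_n tends to 0 at the parent of eta, so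
    P_n(eta) has the same limit as the nonincreasing sequence S_n(eta); this
    limit is 0, because sum_n (1 - omega_n((x_k))) diverges.

    The cleaning operators are the case omega_n((x)) = 1 - f_n(x),
    omega_n((x,y)) = f_n(x) ([cleaning_cloudmx]). *)

(** * Sums of nonnegative families *)

Section UnorderedSums.
Context {R : realType}.

(** An infinite scalar has to be covered: the entries of a cloud matrix may be
    infinite, and they occur as scalars in a product of two such matrices. *)
Lemma ge0_esumZl (T : choiceType) (D : set T) (k : \bar R) (a : T -> \bar R) :
  0 <= k -> (forall i, 0 <= a i) ->
  k * (\esum_(i in D) a i) = \esum_(i in D) (k * a i).
Proof.
move=> k0 a0.
have finE (A : set T) : \sum_(i \in A) (k * a i) = k * \sum_(i \in A) a i.
  by rewrite ge0_mule_fsumr.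
case: k k0 finE => [r| |//] k0 finE.
- rewrite /esum -ereal_supZl//; last by apply/set0P; exists 0; exists set0;
    [exact: fsets_set0|rewrite fsbig_set0].
  rewrite image_comp; congr ereal_sup; apply: eq_imagel => A _ /=.
  by rewrite finE.
- apply/eqP; rewrite eq_le; apply/andP; split; last first.
    apply: ge_ereal_sup => _ [A DA <-]; rewrite finE; apply: lee_pmul => //.
      by apply: fsume_ge0.
    by apply: ereal_sup_ubound; exists A.
  have [->|S0] := eqVneq (\esum_(i in D) a i) 0.
    by rewrite mule0; apply: esum_ge0 => i _; rewrite mule_ge0.
  have : 0 < (\esum_(i in D) a i) by rewrite lt0e S0 esum_ge0.
  move=> /ereal_sup_gt[_ [A DA <-] A0].
  apply: esum_ge; exists A => //; rewrite finE.
  by rewrite !gt0_mulye// lt0e S0 esum_ge0.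
Qed.

Lemma ge0_esumZr (T : choiceType) (D : set T) (k : \bar R) (a : T -> \bar R) :
  0 <= k -> (forall i, 0 <= a i) ->
  (\esum_(i in D) a i) * k = \esum_(i in D) (a i * k).
Proof.
move=> k0 a0; rewrite muleC ge0_esumZl//.
by apply: eq_esum => i _; rewrite muleC.
Qed.

Lemma esum_fibers (T Z : choiceType) (f : T -> Z) (D : set T)
    (a : Z -> T -> \bar R) : (forall z t, 0 <= a z t) ->
  \esum_(z in [set: Z]) \esum_(t in D `&` [set t | f t = z]) a z t
  = \esum_(t in D) a (f t) t.
Proof.
move=> a0; rewrite esum_esum//.
apply: (reindex_esum D _ (fun t => (f t, t)) (fun p => a p.1 p.2)); split.
- by move=> t Dt.
- by move=> t u _ _ [_].
- by move=> [z t] [/= _ [Dt <-]]; exists t.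
Qed.

Lemma esum_supp1 (T : choiceType) (D : set T) (t : T) (a : T -> \bar R) :
  D t -> 0 <= a t -> (forall i, D i -> i != t -> a i = 0) ->
  \esum_(i in D) a i = a t.
Proof.
move=> Dt at0 Da; rewrite -[RHS](esum_set1 at0) esum_mkcond [RHS]esum_mkcond.
apply: eq_esum => i _; rewrite (_ : (i \in [set t]) = (i == t)); last first.
  by apply/idP/eqP => [/set_mem|->] //; exact: mem_set.
case: ifPn => [/set_mem Di|]; first by case: ifPn => //; exact: Da.
by case: eqP => // -> /negP[]; exact: mem_set.
Qed.

(** A pair (s, t) is the same thing as the word s ++ t with a marked cut. *)
Lemma esum_cat (T : countType) (P : set (seq T))
    (F : seq T -> seq T -> \bar R) :
  (forall s t, 0 <= F s t) ->
  \esum_(s in [set: seq T]) \esum_(t in [set t | P (s ++ t)]) F s t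
  = \esum_(u in P) \sum_(j < (size u).+1) F (take j u) (drop j u).
Proof.
move=> F0; rewrite esum_esum//.
under [RHS]eq_esum => u _ do rewrite (fsbig_ord _ _
  (fun j => F (take j u) (drop j u))) -esum_fset//.
rewrite [RHS]esum_esum//.
pose e (p : seq T * seq T) := (p.1 ++ p.2, size p.1).
rewrite [RHS](reindex_esum
    ([set: seq T] `*`` (fun s => [set t | P (s ++ t)])) _ e) /e/=.
  by apply: eq_esum => -[s t] _ /=; rewrite take_size_cat// drop_size_cat.
split.
- by move=> [s t] /= [_ Pst]; rewrite ltnS size_cat leq_addr.
- move=> [s t] [s' t'] _ _ [st sz].
  by move/eqP: st; rewrite eqseq_cat// => /andP[/eqP -> /eqP ->].
- move=> [u j] [/= Pu ju]; exists (take j u, drop j u) => /=.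
    by rewrite cat_take_drop.
  by rewrite cat_take_drop size_takel.
Qed.

Lemma esum_dominated_cvg0 (T : choiceType) (F : nat -> T -> R) (G : T -> R) :
  (forall n t, 0 <= F n t <= G t)%R ->
  \esum_(t in [set: T]) (G t)%:E < +oo ->
  (forall t, F n t @[n --> \oo] --> (0 : R)%R) ->
  \esum_(t in [set: T]) (F n t)%:E @[n --> \oo] --> 0.
Proof.
move=> FG Goo Fcvg.
have F0 n t : 0 <= (F n t)%:E by rewrite lee_fin; case/andP: (FG n t).
have leFG n t : (F n t)%:E <= (G t)%:E by rewrite lee_fin; case/andP: (FG n t).
have G0 t : 0 <= (G t)%:E by exact: le_trans (F0 0%N t) (leFG 0%N t).
have fin_le u : 0 <= u -> u <= \esum_(t in [set: T]) (G t)%:E ->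
    u \is a fin_num.
  by move=> u0 uG; rewrite ge0_fin_numE// (le_lt_trans uG).
have Gfin : (\esum_(t in [set: T]) (G t)%:E) \is a fin_num.
  by apply: fin_le => //; exact: esum_ge0.
have Ffin n : (\esum_(t in [set: T]) (F n t)%:E) \is a fin_num.
  by apply: fin_le; [exact: esum_ge0|exact: le_esum].
apply: cvg_EFin; first exact: nearW.
apply/cvgrPdist_le => e e0.
(* Outside a suitable finite set A the dominating family sums to at most
   e / 2, and on A the sum is finite, so that its limit is termwise. *)
have : \esum_(t in [set: T]) (G t)%:E - (e / 2)%:E <
    \esum_(t in [set: T]) (G t)%:E.
  by rewrite lteBlDr// lteDl// lte_fin divr_gt0.
move=> /ereal_sup_gt[_ [A [finA _] <-]] GA.
have tail n : \esum_(t in [set: T] `&` ~` A) (F n t)%:E <= (e / 2)%:E.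
  apply: le_trans (le_esum (fun t _ => leFG n t)) _.
  have GE := @esumID _ _ A [set: T] _ (fun t _ => G0 t).
  have GAE : \esum_(t in [set: T] `&` A) (G t)%:E = \sum_(t \in A) (G t)%:E.
    by rewrite setTI esum_fset.
  move: Gfin GA; rewrite GE GAE.
  set u := \sum_(t \in A) _; set v := (\esum_(t in _ `&` _) _).
  rewrite fin_numD => /andP[ufin vfin].
  by rewrite lteBlDr// lteD2lE// => /ltW.
have head : (\sum_(t <- finmap.enum_fset (fset_set A)) F n t)%R @[n --> \oo]
    --> (0 : R)%R.
  elim: (finmap.enum_fset (fset_set A)) => [|t r IH].
    by under eq_fun do rewrite big_nil; exact: cvg_cst.
  under eq_fun do rewrite big_cons.
  by have := cvgD (Fcvg t) IH; rewrite addr0; apply.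
have e2 : (0 < e / 2)%R by rewrite divr_gt0.
move/cvgrPdist_le : head => /(_ _ e2); apply: filterS => n.
rewrite !sub0r !normrN => head.
rewrite /= ger0_norm ?fine_ge0 ?esum_ge0// -lee_fin fineK//.
rewrite (esumID A)// setTI esum_fset// fsumEFin// fsbig_finite//=.
rewrite [e]splitr EFinD; apply: leeD => //.
by rewrite lee_fin (le_trans (ler_norm _)).
Qed.

(** A sequence summable against weights of infinite total mass cannot stay away
    from 0. *)
Lemma limit_weight_eq0 (u b : nat -> R) (l M : R) :
  (forall n, 0 <= u n)%R -> (forall n, 0 <= b n)%R ->
  \sum_(0 <= n <oo) (b n)%:E = +oo ->
  (forall n, \sum_(0 <= i < n) u i * b i <= M)%R ->
  u n @[n --> \oo] --> l -> l = 0%R.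
Proof.
move=> u0 b0 boo ubM ul.
have l0 : (0 <= l)%R by apply: cvgr_to_ge ul _; exact: nearW.
apply/eqP; rewrite eq_le l0 andbT leNgt; apply/negP => lpos.
have l2 : (0 < l / 2)%R by rewrite divr_gt0.
move/cvgrPdist_le : ul => /(_ _ l2) [N _ hN].
have hu n : (N <= n)%N -> (l / 2 <= u n)%R.
  move=> /hN /=; rewrite ler_norml => /andP[_]; lra.
pose C := (\sum_(0 <= i < N) b i + M / (l / 2))%R.
have bC n : (\sum_(0 <= i < n) b i <= C)%R.
  have M0 : (0 <= M)%R by have := ubM 0%N; rewrite big_nil.
  have [nN|Nn] := leqP n N.
    rewrite /C -[leLHS]addr0; apply: lerD; last by rewrite divr_ge0// ltW.
    rewrite (big_cat_nat (leq0n _) nN)//= lerDl sumr_ge0//.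
  rewrite (big_cat_nat (leq0n _) (ltnW Nn))//=; apply: lerD => //.
  rewrite ler_pdivlMr// mulr_suml.
  apply: le_trans (ubM n); rewrite [leRHS](big_cat_nat (leq0n _) (ltnW Nn))//=.
  rewrite -[leLHS]add0r; apply: lerD.
    by rewrite sumr_ge0// => i _; rewrite mulr_ge0.
  rewrite big_nat_cond [leRHS]big_nat_cond.
  apply: ler_sum => i /andP[/andP[Ni _] _].
  by rewrite mulrC ler_wpM2r// hu.
have : \sum_(0 <= n <oo) (b n)%:E <= C%:E.
  apply: lime_le; first by apply: is_cvg_nneseries => n _ _; rewrite lee_fin.
  by apply: nearW => n; rewrite sumEFin lee_fin.
by rewrite boo leye_eq.
Qed.

End UnorderedSums.

(** * Convolution of clouds *)

Section Convolution.
Context {R : realType} {X : countType}.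
Implicit Types (mu nu rho : marker X -> R) (x y : X) (s : seq X).
Local Open Scope ring_scope.

Definition cconv mu nu : marker X -> R := fun eta =>
  \sum_(j < (size eta.2).+1)
    mu (eta.1, take j eta.2) * nu (last eta.1 (take j eta.2), drop j eta.2).

Definition cunit : marker X -> R := fun eta => (nilp eta.2)%:R.

(** The zeta function of the prefix order: convolving with it on the right sums
    a cloud over the ancestors of a marker. *)
Definition czeta : marker X -> R := fun=> 1.

(** Cutting the first letter off a marker is how the proof of associativity goes
    by induction on its length, see [cconv_cons]. *)
Definition cshift x mu : marker X -> R := fun eta => mu (x, eta.1 :: eta.2).

Lemma cconv_nil mu nu x : cconv mu nu (x, [::]) = mu (x, [::]) * nu (x, [::]).
Proof. by rewrite /cconv big_ord1. Qed.

Lemma cconv_cons mu nu x y s :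
  cconv mu nu (x, y :: s)
  = mu (x, [::]) * nu (x, y :: s) + cconv (cshift x mu) nu (y, s).
Proof. by rewrite /cconv big_ord_recl. Qed.

Lemma cconv_last mu nu eta :
  cconv mu nu eta
  = \sum_(j < size eta.2)
      mu (eta.1, take j eta.2) * nu (last eta.1 (take j eta.2), drop j eta.2)
    + mu eta * nu (last eta.1 eta.2, [::]).
Proof.
by rewrite /cconv big_ord_recr/= take_size drop_size -surjective_pairing.
Qed.

Lemma cconvDl mu mu' nu eta :
  cconv (mu \+ mu') nu eta = cconv mu nu eta + cconv mu' nu eta.
Proof. by rewrite /cconv -big_split; apply: eq_bigr => j _; rewrite mulrDl. Qed.

Lemma cconvZl (k : R) mu nu eta :
  cconv (fun e => k * mu e) nu eta = k * cconv mu nu eta.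
Proof. by rewrite /cconv mulr_sumr; apply: eq_bigr => j _; rewrite mulrA. Qed.

Lemma cconvA : associative cconv.
Proof.
move=> mu nu rho; apply/funext => -[x s]; elim: s x mu nu => [|y s IH] x mu nu.
  by rewrite !cconv_nil mulrA.
have shiftE : cshift x (cconv mu nu) =
    (fun e => mu (x, [::]) * cshift x nu e) \+ cconv (cshift x mu) nu.
  by apply/funext => -[z t]; rewrite /cshift cconv_cons.
rewrite [LHS]cconv_cons [RHS]cconv_cons shiftE cconvDl cconvZl -IH.
by rewrite cconv_cons cconv_nil mulrDr -!mulrA addrA.
Qed.

Lemma cconv1l : left_id cunit cconv.
Proof.
move=> nu; apply/funext => -[x s]; rewrite /cconv big_ord_recl/=.
rewrite take0 drop0 mul1r.
rewrite big1 ?addr0// => i _; rewrite /cunit /nilp /= size_takel// mul0r//.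
Qed.

Lemma cconv1r : right_id cunit cconv.
Proof.
move=> nu; apply/funext => -[x s]; rewrite cconv_last/= mulr1.
rewrite big1 ?add0r// => i _.
by rewrite /cunit /nilp /= size_drop subn_eq0 leqNgt ltn_ord mulr0.
Qed.

HB.instance Definition _ :=
  Monoid.isLaw.Build (marker X -> R) cunit cconv cconvA cconv1l cconv1r.

Lemma cconv_ge0 mu nu : (forall e, 0 <= mu e) -> (forall e, 0 <= nu e) ->
  forall e, 0 <= cconv mu nu e.
Proof. by move=> m0 n0 e; apply: sumr_ge0 => j _; rewrite mulr_ge0. Qed.

Lemma cunit_ge0 eta : 0 <= cunit eta. Proof. exact: ler0n. Qed.

Definition cdiag (f : X -> R) : marker X -> R := fun eta => f eta.1 * cunit eta.

Lemma cconv_cdiagl f nu eta : cconv (cdiag f) nu eta = f eta.1 * nu eta.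
Proof.
rewrite -[in RHS](cconv1l nu) /cconv mulr_sumr; apply: eq_bigr => j _.
by rewrite mulrA.
Qed.

Lemma cconv_cdiagr f nu eta :
  cconv nu (cdiag f) eta = nu eta * f (last eta.1 eta.2).
Proof.
rewrite -[in RHS](cconv1r nu) /cconv mulr_suml; apply: eq_bigr => j _.
rewrite /cdiag /cunit /=; case: nilP => [d0|_]; last by rewrite !mulr0 mul0r.
have -> : last eta.1 (take j eta.2) = last eta.1 eta.2.
  by rewrite -[in RHS](cat_take_drop j eta.2) d0 cats0.
by rewrite !mulr1.
Qed.

End Convolution.

(** * Matrices of clouds *)

Section CloudMatrices.
Context {R : realType} {X : countType} {a : X -> X -> R}.
Hypothesis a_ge0 : forall x y, (0 <= a x y)%R.
Implicit Types (mu nu : marker X -> R) (x y : X) (s t : seq X).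

Lemma mweight_nil x : mweight a (x, [::]) = 1%R.
Proof. by rewrite /mweight big_ord0. Qed.

(** Markers starting at x and at y use different default values in [mnth], but
    every index involved is in range. *)
Lemma mweight_cons x y s :
  mweight a (x, y :: s) = (a x y * mweight a (y, s))%R.
Proof.
rewrite /mweight big_ord_recl /=; congr (_ * _)%R; apply: eq_bigr => j _.
rewrite /mnth /= /bump /=; congr (a _ _); apply: set_nth_default => //=.
  exact: ltnW (ltn_ord j).
exact: ltn_ord.
Qed.

Lemma mweight_cat x s t :
  mweight a (x, s ++ t) = (mweight a (x, s) * mweight a (last x s, t))%R.
Proof.
elim: s x => [|y s IH] x /=; first by rewrite mweight_nil mul1r.
by rewrite !mweight_cons IH mulrA.
Qed.

Lemma mweight_ge0 eta : (0 <= mweight a eta)%R.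
Proof. exact: prodr_ge0. Qed.

Lemma mnth_mlen (eta : marker X) : mnth eta (mlen eta) = last eta.1 eta.2.
Proof. by rewrite /mnth /mlen (last_nth eta.1). Qed.

Lemma cloudmxE nu x y :
  cloudmx a nu x y =
  \esum_(s in [set s | last x s = y]) (nu (x, s) * mweight a (x, s))%:E.
Proof.
rewrite /cloudmx; apply: (reindex_esum _ _ (pair x)); split.
- by move=> s /= sy; rewrite mnth_mlen.
- by move=> s s' _ _ [].
- by move=> [z s] [/= zx]; rewrite mnth_mlen/= => sy; exists s;
    rewrite /= -zx.
Qed.

Lemma cloudmx_ge0 nu x y : (forall e, 0 <= nu e)%R -> 0 <= cloudmx a nu x y.
Proof.
by move=> nu0; apply: esum_ge0 => e _; rewrite lee_fin mulr_ge0// mweight_ge0.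
Qed.

(** A pair of composable markers (eta, theta) is one marker with a distinguished
    vertex, and [mweight] is multiplicative; regrouping the double sum by the
    joined marker leaves the convolution of the clouds as coefficient. *)
Lemma cloudmx_mul mu nu : (forall e, 0 <= mu e)%R -> (forall e, 0 <= nu e)%R ->
  emxmul (cloudmx a mu) (cloudmx a nu) = cloudmx a (cconv mu nu).
Proof.
move=> mu0 nu0; apply/funext => x; apply/funext => y.
pose F (r : marker X -> R) x s : \bar R := (r (x, s) * mweight a (x, s))%:E.
have F0 r z s : (forall e, 0 <= r e)%R -> 0 <= F r z s.
  by move=> r0; rewrite lee_fin mulr_ge0// mweight_ge0.
transitivity (\esum_(z in [set: X])
    \esum_(s in [set: seq X] `&` [set s | last x s = z])
      (F mu x s * cloudmx a nu z y)).
  apply: eq_esum => z _; rewrite cloudmxE setTI ge0_esumZr//.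
  - exact: cloudmx_ge0.
  - by move=> s; exact: F0.
rewrite esum_fibers; last first.
  by move=> z s; rewrite mule_ge0 ?cloudmx_ge0// F0.
transitivity (\esum_(s in [set: seq X])
   \esum_(t in [set t | last x (s ++ t) = y]) (F mu x s * F nu (last x s) t)).
  apply: eq_esum => s _; rewrite cloudmxE ge0_esumZl ?F0//; last first.
    by move=> t; exact: F0.
  by congr (esum _ _); apply/seteqP; split => t /=; rewrite last_cat.
rewrite cloudmxE.
rewrite (@esum_cat _ _ [set u | last x u = y]
  (fun s t => F mu x s * F nu (last x s) t)); last first.
  by move=> s t; rewrite mule_ge0// F0.
apply: eq_esum => u _; rewrite /cconv /= mulr_suml -sumEFin.
apply: eq_bigr => j _; rewrite /F -EFinM.
rewrite -[in mweight a (x, u)](cat_take_drop j u) mweight_cat.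
by rewrite mulrACA.
Qed.

Lemma cloudmx_add mu nu : (forall e, 0 <= mu e)%R -> (forall e, 0 <= nu e)%R ->
  emxadd (cloudmx a mu) (cloudmx a nu) = cloudmx a (mu \+ nu)%R.
Proof.
move=> mu0 nu0; apply/funext => x; apply/funext => y.
rewrite /emxadd /cloudmx -esumD.
- by apply: eq_esum => e _; rewrite -EFinD -mulrDl.
- by move=> e _; rewrite lee_fin mulr_ge0// mweight_ge0.
- by move=> e _; rewrite lee_fin mulr_ge0// mweight_ge0.
Qed.

Lemma cdiag_ge0 (f : X -> R) : (forall x, 0 <= f x)%R ->
  forall e, (0 <= cdiag f e)%R.
Proof. by move=> f0 e; rewrite mulr_ge0// cunit_ge0. Qed.

Lemma cloudmx_diag (f : X -> R) : (forall x, 0 <= f x)%R ->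
  cloudmx a (cdiag f) = ediag f.
Proof.
move=> f0; apply/funext => x; apply/funext => y; rewrite cloudmxE /ediag.
have supp s : s != [::] -> (cdiag f (x, s) * mweight a (x, s))%:E = 0 :> \bar R.
  by case: s => // z s _; rewrite /cdiag /cunit /= mulr0 mul0r.
case: eqVneq => [<-|xy].
  rewrite (@esum_supp1 _ _ _ [::])//; last by move=> s _; exact: supp.
    by rewrite mweight_nil mulr1 /cdiag /cunit /= mulr1.
  by rewrite lee_fin mulr_ge0 ?mweight_ge0 ?cdiag_ge0.
apply: esum1 => s /= sy; apply: supp; apply: contraNneq xy => s0.
by rewrite -sy s0.
Qed.

Lemma cloudmx_one : cloudmx a cunit = emx1 :> (X -> X -> \bar R).
Proof.
rewrite /emx1 -cloudmx_diag//; congr cloudmx; apply/funext => e.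
by rewrite /cdiag mul1r.
Qed.

Definition cstep : marker X -> R := fun eta => (size eta.2 == 1%N)%:R.

Lemma cloudmx_step : cloudmx a cstep = emx_of a.
Proof.
apply/funext => x; apply/funext => y; rewrite cloudmxE /emx_of.
rewrite (@esum_supp1 _ _ _ [:: y])//.
- by rewrite mweight_cons mweight_nil /cstep /= mulr1 mul1r.
- by rewrite lee_fin mulr_ge0 ?mweight_ge0.
- move=> [|z [|z' s]] /= sy nsy; rewrite /cstep /= ?mul0r//.
  by rewrite sy eqxx in nsy.
Qed.

Lemma cleaning_cloudmx (f : X -> R) : (forall x, 0 <= f x <= 1)%R ->
  cleaning a f =
  cloudmx a (cdiag (fun x => 1 - f x)%R \+ cconv (cdiag f) cstep)%R.
Proof.
move=> f01.
have f0 x : (0 <= f x)%R by case/andP: (f01 x).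
have g0 x : (0 <= 1 - f x)%R by rewrite subr_ge0; case/andP: (f01 x).
have step0 (e : marker X) : (0 <= cstep e :> R)%R by exact: ler0n.
rewrite /cleaning -(cloudmx_diag (fun x => 1 - f x)%R)//.
rewrite -(cloudmx_diag f)// -cloudmx_step.
rewrite cloudmx_mul//; last exact: cdiag_ge0.
rewrite cloudmx_add//; first exact: cdiag_ge0.
by apply: cconv_ge0 => //; exact: cdiag_ge0.
Qed.

Lemma cloudmx_prod (omega : nat -> marker X -> R) n :
  (forall i e, 0 <= omega i e)%R ->
  emxprod (fun i => cloudmx a (omega i)) n =
    cloudmx a (\big[cconv/cunit]_(0 <= i < n) omega i) /\
  (forall e, 0 <= (\big[cconv/cunit]_(0 <= i < n) omega i) e)%R.
Proof.
move=> om0; rewrite /emxprod.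
pose K A nu := A = cloudmx a nu /\ forall e : marker X, (0 <= nu e)%R.
apply: (big_ind2 K); rewrite /K.
- by split; [rewrite cloudmx_one|exact: cunit_ge0].
- move=> A mu B nu [-> mu0] [-> nu0].
  by split; [rewrite cloudmx_mul|exact: cconv_ge0].
- by move=> i _; split.
Qed.

Lemma cloudmx_pow nu k : (forall e, 0 <= nu e)%R ->
  emxpow (cloudmx a nu) k = cloudmx a (iter k (cconv nu) cunit) /\
  (forall e, 0 <= (iter k (cconv nu) cunit) e)%R.
Proof.
move=> nu0; elim: k => [|k [IH IH0]] /=.
  by split; [rewrite /emxpow/= cloudmx_one|exact: cunit_ge0].
split; last exact: cconv_ge0.
by rewrite -cloudmx_mul// -IH.
Qed.

Lemma sandwich_cloudmx (c w : X -> R) nu : (forall x, 0 <= c x)%R ->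
  (forall x, 0 <= w x)%R -> (forall e, 0 <= nu e)%R ->
  esandwich c (cloudmx a nu) w =
  \esum_(e in [set: marker X])
    (nu e * (c e.1 * mweight a e * w (last e.1 e.2)))%:E.
Proof.
move=> c0 w0 nu0.
pose en (e : marker X) := last e.1 e.2.
have N0 (e : marker X) : 0 <= (nu e * mweight a e)%:E :> \bar R.
  by rewrite lee_fin mulr_ge0 ?mweight_ge0.
have row y : erowmul (EFin \o c) (cloudmx a nu) y =
    \esum_(e in [set e | en e = y]) ((c e.1)%:E * (nu e * mweight a e)%:E).
  rewrite -(@esum_fibers _ _ _ fst [set e | en e = y]
    (fun x e => (c x)%:E * (nu e * mweight a e)%:E)); last first.
    by move=> x e; rewrite mule_ge0 ?N0 ?lee_fin.
  apply: eq_esum => x _; rewrite /cloudmx ge0_esumZl ?lee_fin//.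
  congr (esum _ _); apply/seteqP; split => e /=; rewrite mnth_mlen.
    by move=> [].
  by move=> [].
rewrite /esandwich /edot.
transitivity (\esum_(y in [set: X])
    \esum_(e in [set: marker X] `&` [set e | en e = y])
      ((c e.1)%:E * (nu e * mweight a e)%:E * (w y)%:E)).
  apply: eq_esum => y _; rewrite row setTI ge0_esumZr ?lee_fin//.
  by move=> e; rewrite mule_ge0 ?N0 ?lee_fin.
rewrite (@esum_fibers _ _ _ en); last first.
  by move=> y e; rewrite !mule_ge0 ?N0 ?lee_fin.
apply: eq_esum => e _; rewrite -!EFinM; congr (_%:E).
by rewrite /en mulrCA -!mulrA.
Qed.

End CloudMatrices.

(** * Pointwise decay of products of clouds *)

Section PathSums.
Context {R : realType} {X : countType}.
Implicit Types (nu : marker X -> R) (x y : X) (s : seq X).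
Local Open Scope ring_scope.

Lemma path_sum_rcons nu x s y :
  cconv nu czeta (x, rcons s y) = cconv nu czeta (x, s) + nu (x, rcons s y).
Proof.
rewrite cconv_last mulr1 /cconv /= size_rcons; congr (_ + _).
apply: eq_bigr => j _; rewrite !mulr1 -cats1 takel_cat//.
by rewrite -ltnS ltn_ord.
Qed.

Lemma le_path_sum nu : (forall e, 0 <= nu e) ->
  forall e, nu e <= cconv nu czeta e.
Proof.
move=> nu0 e; rewrite cconv_last mulr1 lerDr sumr_ge0// => j _.
by rewrite mulr1.
Qed.

Lemma cloud_norm_path_sum nu : (forall e, 0 <= nu e) ->
  (cloud_norm nu <= 1)%E -> forall e, cconv nu czeta e <= 1.
Proof.
move=> nu0 nu1 e; rewrite -lee_fin; apply: le_trans nu1.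
apply: ereal_sup_ubound; exists e => //; congr EFin.
by apply: eq_bigr => j _; rewrite mulr1 ger0_norm.
Qed.

End PathSums.

Section ProductsDecay.
Context {R : realType} {X : countType} (omega : nat -> marker X -> R).
Local Open Scope ring_scope.
Hypothesis omega_ge0 : forall n e, 0 <= omega n e.
Hypothesis omega_le1 : forall n e, cconv (omega n) czeta e <= 1.

Let P n := \big[cconv/cunit]_(0 <= i < n) omega i.
Let S n := cconv (P n) czeta.

Lemma cprod_recr n : P n.+1 = cconv (P n) (omega n).
Proof. by rewrite /P big_nat_recr. Qed.

Lemma cprod_ge0 n e : 0 <= P n e.
Proof.
elim: n e => [|n IH] e; first by rewrite /P big_nil cunit_ge0.
by rewrite cprod_recr cconv_ge0.
Qed.

(** The difference is P_n * (1 - omega_n * 1) at e, a sum of nonnegative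
    terms; its last term is the left-hand side. *)
Lemma path_sum_decrease n (e : marker X) :
  P n e * (1 - omega n (last e.1 e.2, [::])) <= S n e - S n.+1 e.
Proof.
rewrite /S cprod_recr -cconvA.
rewrite cconv_last [cconv (P n) (cconv _ _) e]cconv_last cconv_nil.
rewrite opprD addrACA mulrBr !mulr1 lerDr subr_ge0; apply: ler_sum => j _.
by rewrite ler_wpM2l ?cprod_ge0.
Qed.

Lemma omega_root_le1 n x : 0 <= 1 - omega n (x, [::]).
Proof.
by rewrite subr_ge0; have := omega_le1 n (x, [::]); rewrite cconv_nil mulr1.
Qed.

Lemma path_sum_nonincreasing n e : S n.+1 e <= S n e.
Proof.
rewrite -subr_ge0; apply: le_trans (path_sum_decrease n e).
by rewrite mulr_ge0 ?cprod_ge0 ?omega_root_le1.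
Qed.

Lemma path_sum_cprod_ge0 n e : 0 <= S n e.
Proof. by apply: cconv_ge0 => // e'; exact: cprod_ge0. Qed.

Lemma path_sum_cprod0 e : S 0%N e = 1.
Proof. by rewrite /S /P big_nil cconv1l. Qed.

Lemma cprod_le1 n e : P n e <= 1.
Proof.
apply: le_trans (le_path_sum _ _ e) _ => [e'|]; first exact: cprod_ge0.
elim: n => [|n IH]; first by rewrite -(path_sum_cprod0 e).
exact: le_trans (path_sum_nonincreasing n e) IH.
Qed.

Lemma path_sum_telescope n (e : marker X) :
  \sum_(0 <= i < n) P i e * (1 - omega i (last e.1 e.2, [::])) <= 1.
Proof.
have H : \sum_(0 <= i < n) P i e * (1 - omega i (last e.1 e.2, [::]))
    <= S 0%N e - S n e.
  elim: n => [|n IH]; first by rewrite big_nil subrr.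
  rewrite big_nat_recr//=; apply: le_trans (lerD IH (path_sum_decrease n e)) _.
  by rewrite addrA subrK.
apply: le_trans H _; rewrite path_sum_cprod0 lerBlDr lerDl.
exact: path_sum_cprod_ge0.
Qed.

(** Induction on the length: once the path sum of the parent of e tends to 0,
    P n e and the convergent sequence S n e have the same limit, and
    [path_sum_telescope] leaves 0 as the only possible one. *)
Lemma cprod_cvg0 (L : set X) :
  (forall x, L x -> (\sum_(0 <= n <oo) (1 - omega n (x, [::]))%:E = +oo)%E) ->
  forall e : marker X, all (fun x => x \in L) (e.1 :: e.2) ->
  P n e @[n --> \oo] --> (0 : R).
Proof.
move=> omegaoo [x s] xsL.
have step (e : marker X) (l : R) : last e.1 e.2 \in L ->
    P n e @[n --> \oo] --> l -> l = 0.
  move=> /set_mem eL; apply: limit_weight_eq0 (omegaoo _ eL) _.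
  - by move=> n; exact: cprod_ge0.
  - by move=> n; exact: omega_root_le1.
  - by move=> n; exact: path_sum_telescope.
have Scvg e : cvgn (fun n => S n e).
  apply: nonincreasing_is_cvgn.
    by apply/nonincreasing_seqP => n; exact: path_sum_nonincreasing.
  by exists 0 => _ [n _ <-]; exact: path_sum_cprod_ge0.
suff S0 : S n (x, s) @[n --> \oo] --> (0 : R).
  apply: (squeeze_cvgr _ (cvg_cst 0) S0); apply: nearW => n.
  by rewrite cprod_ge0 le_path_sum// => e; exact: cprod_ge0.
elim/last_ind: s xsL => [|s y IH] xsL.
  have E n : S n (x, [::]) = P n (x, [::]) by rewrite /S cconv_nil mulr1.
  under eq_fun do rewrite E.
  have Pl : P n (x, [::]) @[n --> \oo] --> limn (fun n => S n (x, [::])).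
    by under eq_fun do rewrite -E; exact: Scvg.
  have l0 : limn (fun n => S n (x, [::])) = 0.
    by apply: (step (x, [::])) => //=; case/andP: xsL.
  by move: Pl; rewrite l0.
have := xsL; rewrite /= all_rcons => /and3P[xL yL sL].
have {IH}S0 : S n (x, s) @[n --> \oo] --> (0 : R) by apply: IH; rewrite /= xL.
have E n : S n (x, rcons s y) = S n (x, s) + P n (x, rcons s y).
  exact: path_sum_rcons.
have Pl : P n (x, rcons s y) @[n --> \oo]
    --> limn (fun n => S n (x, rcons s y)) - 0.
  have PE n : P n (x, rcons s y) = S n (x, rcons s y) - S n (x, s).
    by rewrite E addrC addKr.
  by under eq_fun do rewrite PE; apply: cvgB => //; exact: Scvg.
have l0 : limn (fun n => S n (x, rcons s y)) - 0 = 0.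
  by apply: (step (x, rcons s y)) => //=; rewrite last_rcons.
by have := Scvg (x, rcons s y); move: l0; rewrite subr0 => <-.
Qed.

End ProductsDecay.

(** * Markers inside L *)

Section SupportInL.
Context {R : realType} {X : countType} (L : set X).
Implicit Types (mu nu : marker X -> R) (e : marker X).
Local Open Scope ring_scope.
Local Notation inL := (fun x => x \in L).

(** The boolean counterpart of [carried_by], stable under convolution because
    [belast] is compatible with concatenation. *)
Definition carried_in nu :=
  forall e, nu e != 0 -> all inL (belast e.1 e.2).

Lemma carried_by_in nu : carried_by nu L -> carried_in nu.
Proof.
move=> nuL [x s] /= nu0; apply: contraNT nu0 => /(all_nthP x) H.
apply/eqP; apply: nuL; apply: contrapT => H2; apply: H => j.
rewrite size_belast => js; apply/mem_set; apply: contrapT => nL.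
apply: H2; exists j => //; rewrite /mnth /= lastI nth_rcons size_belast js.
exact: nL.
Qed.

Lemma carried_in_cconv mu nu :
  carried_in mu -> carried_in nu -> carried_in (cconv mu nu).
Proof.
move=> muL nuL [x s] /= H.
have [j] : exists j : 'I_(size s).+1,
    mu (x, take j s) * nu (last x (take j s), drop j s) != 0.
  apply/existsP; apply: contraNT H; rewrite negb_exists => /forallP H.
  by apply/eqP; apply: big1 => j _; have := H j; rewrite negbK => /eqP.
rewrite mulf_eq0 negb_or => /andP[/muL /= m /nuL /= n].
by rewrite -[s](cat_take_drop j) belast_cat all_cat m n.
Qed.

Lemma carried_in_cprod (omega : nat -> marker X -> R) n :
  (forall i, carried_in (omega i)) ->
  carried_in (\big[cconv/cunit]_(0 <= i < n) omega i).
Proof.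
move=> omL; apply: big_ind => //; last exact: carried_in_cconv.
by move=> [x [|y s]]//=; rewrite /cunit /= eqxx.
Qed.

Definition cinside : marker X -> R := fun e => (all inL (e.1 :: e.2))%:R.

(** The cloud of I_L alpha I_L. *)
Definition cstepL : marker X -> R :=
  cconv (cconv (cdiag \1_L) cstep) (cdiag \1_L).

(** For k >= 1 the cloud of (I_L alpha I_L)^k is the indicator of the markers
    with k steps inside L; for k = 0 it is the unit cloud, which is not confined
    to L, whence an inequality. *)
Lemma cinside_le_pow e : cinside e <= iter (size e.2) (cconv cstepL) cunit e.
Proof.
have indic0 x : 0 <= \1_L x :> R by rewrite indicE.
have cstepL0 e' : 0 <= cstepL e'.
  apply: cconv_ge0 => [|e'']; last exact: cdiag_ge0.
  by apply: cconv_ge0 => [|e'']; [exact: cdiag_ge0|exact: ler0n].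
have pow0 k e' : 0 <= iter k (cconv cstepL) cunit e'.
  elim: k e' => [|k IH] e'; [exact: cunit_ge0|exact: cconv_ge0].
case: e => x s; rewrite /cinside; elim: s x => [|y s IH] x /=.
  by rewrite /cunit /= lern1 leq_b1.
rewrite cconv_cons; apply: le_trans (_ : cstepL (x, [:: y]) *
    iter (size s) (cconv cstepL) cunit (y, s) <= _).
  rewrite /cstepL cconv_cdiagr cconv_cdiagl /cstep /= mulr1 !indicE.
  case: (x \in L) => /=; rewrite ?mul0r// mul1r.
  case yL : (y \in L) => /=; rewrite ?mul0r// mul1r.
  by have := IH y; rewrite /= yL.
rewrite -[leLHS]add0r; apply: lerD; first by rewrite mulr_ge0.
rewrite /cconv /= big_ord_recl /= take0 drop0 lerDl sumr_ge0// => j _.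
by apply: mulr_ge0; [exact: cstepL0|exact: pow0].
Qed.

End SupportInL.

(** * Products of cloud matrices *)

Section CloudProducts.
Context {R : realType} {X : countType}.
Context (a : X -> X -> R) (L : set X) (c w : X -> R).
Hypothesis a_ge0 : forall x y, (0 <= a x y)%R.
Hypothesis c_ge0 : forall x, (0 <= c x)%R.
Hypothesis w_ge0 : forall x, (0 <= w x)%R.
Hypothesis fin_cw : \sum_(0 <= k <oo)
    esandwich c (emxpow (emxmul (emxmul (eproj L) (emx_of a)) (eproj L)) k) w
  < +oo.

Let weight (e : marker X) : R := (c e.1 * mweight a e * w (last e.1 e.2))%R.

Lemma weight_ge0 e : (0 <= weight e)%R.
Proof. by rewrite !mulr_ge0// mweight_ge0. Qed.

Let indic_ge0 x : (0 <= \1_L x :> R)%R. Proof. by rewrite indicE. Qed.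

Lemma eproj_cloudmx : eproj L = cloudmx a (cdiag \1_L).
Proof. by rewrite cloudmx_diag. Qed.

(** Grouping the markers inside L by their length k bounds the sum by the
    series of the c (I_L alpha I_L)^k w. *)
Lemma esum_inside_fin :
  \esum_(e in [set: marker X]) (cinside L e * weight e)%:E < +oo.
Proof.
apply: le_lt_trans fin_cw.
have diag0 := cdiag_ge0 _ indic_ge0.
have step0 (e : marker X) : (0 <= cstep e :> R)%R by exact: ler0n.
have LaL :
    emxmul (emxmul (eproj L) (emx_of a)) (eproj L) = cloudmx a (cstepL L).
  rewrite eproj_cloudmx -(cloudmx_step a_ge0) !cloudmx_mul//.
  exact: cconv_ge0.
have stepL0 e : (0 <= cstepL L e :> R)%R by do 2![apply: cconv_ge0 => // e'].
have pow0 k e : (0 <= iter k (cconv (cstepL L)) cunit e :> R)%R.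
  exact: (cloudmx_pow a_ge0 _ k stepL0).2.
have sandE k : esandwich c (emxpow (cloudmx a (cstepL L)) k) w =
    \esum_(e in [set: marker X])
      (iter k (cconv (cstepL L)) cunit e * weight e)%:E.
  by rewrite (cloudmx_pow a_ge0 _ k stepL0).1 sandwich_cloudmx.
have term0 k e : 0 <= (iter k (cconv (cstepL L)) cunit e * weight e)%:E.
  by rewrite lee_fin mulr_ge0 ?weight_ge0.
rewrite LaL nneseries_esumT; last by move=> k; rewrite sandE; exact: esum_ge0.
rewrite -(@esum_fibers _ _ _ (fun e : marker X => size e.2) setT
  (fun=> fun e => (cinside L e * weight e)%:E)); last first.
  by move=> _ e; rewrite lee_fin mulr_ge0 ?weight_ge0 ?ler0n.
apply: le_esum => k _; rewrite sandE setTI esum_mkcond; apply: le_esum => e _.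
case: ifPn => [/set_mem <-|//].
by rewrite lee_fin ler_wpM2r ?weight_ge0 ?cinside_le_pow.
Qed.

Theorem cloud_product_cvg0 (omega : nat -> marker X -> R) :
  (forall n e, 0 <= omega n e)%R ->
  (forall n e, cconv (omega n) czeta e <= 1)%R ->
  (forall n, carried_in L (omega n)) ->
  (forall x, L x -> \sum_(0 <= n <oo) (1 - omega n (x, [::]))%:E = +oo) ->
  esandwich c
      (emxmul (emxprod (fun i => cloudmx a (omega i)) n) (eproj L)) w
    @[n --> \oo] --> 0.
Proof.
move=> om0 om1 omL omoo.
pose P n := \big[cconv/cunit]_(0 <= i < n) omega i.
have P0 n e : (0 <= P n e)%R by exact: cprod_ge0.
pose F n (e : marker X) : R := (P n e * \1_L (last e.1 e.2) * weight e)%R.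
have FG n e : (0 <= F n e <= cinside L e * weight e)%R.
  apply/andP; split.
    by rewrite mulr_ge0 ?weight_ge0// mulr_ge0// indic_ge0.
  rewrite ler_wpM2r ?weight_ge0//.
  have [->|Pne0] := eqVneq (P n e) 0%R; first by rewrite mul0r ler0n.
  have eL : all (fun x => x \in L) (belast e.1 e.2).
    exact: (carried_in_cprod L omega n omL).
  rewrite /cinside lastI all_rcons eL andbT indicE.
  by rewrite ler_piMl ?ler0n ?cprod_le1.
have FE n : esandwich c
    (emxmul (emxprod (fun i => cloudmx a (omega i)) n) (eproj L)) w
    = \esum_(e in [set: marker X]) (F n e)%:E.
  have diag0 := cdiag_ge0 _ indic_ge0.
  rewrite (cloudmx_prod a_ge0 _ n om0).1 -/(P n) eproj_cloudmx cloudmx_mul//.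
  rewrite sandwich_cloudmx//; last exact: cconv_ge0.
  by apply: eq_esum => e _; rewrite cconv_cdiagr.
under eq_fun do rewrite FE.
apply: (esum_dominated_cvg0 _ _ _ FG esum_inside_fin) => e.
have [eL|eL] := boolP (all (fun x => x \in L) (e.1 :: e.2)).
  rewrite -(mul0r (\1_L (last e.1 e.2) * weight e)%R).
  under eq_fun do rewrite /F -mulrA.
  by apply: cvgMl; exact: cprod_cvg0 omoo e eL.
under eq_fun => n.
  rewrite (_ : F n e = 0%R); last first.
    apply/eqP; rewrite eq_le; have /andP[-> Fle] := FG n e; rewrite andbT.
    by apply: le_trans Fle _; rewrite /cinside (negbTE eL) mul0r.
  over.
exact: cvg_cst.
Qed.

(** Along a marker (x, y, ...) the cloud of a cleaning operator takes the
    values 1 - f x, f x, 0, ..., of sum 1, and its defect at (x) is f x. *)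
Theorem cleaning_product_cvg0 (f : nat -> X -> R) :
  (forall n x, 0 <= f n x <= 1)%R ->
  (forall n x, ~ L x -> f n x = 0%R) ->
  (forall x, L x -> \sum_(0 <= n <oo) (f n x)%:E = +oo) ->
  esandwich c
      (emxmul (emxprod (fun i => cleaning a (f i)) n) (eproj L)) w
    @[n --> \oo] --> 0.
Proof.
move=> f01 fL foo.
pose omega n : marker X -> R :=
  (cdiag (fun x => 1 - f n x)%R \+ cconv (cdiag (f n)) cstep)%R.
have -> : (fun i => cleaning a (f i)) = (fun i => cloudmx a (omega i)).
  by apply/funext => i; exact: cleaning_cloudmx.
have omE n e : omega n e = ((1 - f n e.1) * cunit e + f n e.1 * cstep e)%R.
  by rewrite /omega /= cconv_cdiagl.
have f0 n x : (0 <= f n x)%R by case/andP: (f01 n x).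
have g0 n x : (0 <= 1 - f n x)%R by rewrite subr_ge0; case/andP: (f01 n x).
apply: cloud_product_cvg0.
- by move=> n e; rewrite omE addr_ge0// mulr_ge0// ler0n.
- move=> n e; rewrite /omega cconvDl cconv_cdiagl mulr1 -cconvA cconv_cdiagl.
  rewrite -lerBrDl opprB addrCA subrr addr0 ler_piMr//.
  case: e => x [|y s]; first by rewrite cconv_nil mul0r.
  rewrite cconv_cons mul0r add0r /cconv big_ord_recl /= big1.
    by rewrite addr0 mulr1 /cshift /cstep/= take0.
  by move=> j _; rewrite mulr1 /cshift /cstep /= size_takel.
- move=> n [x [|y [|z s]]] //=.
    rewrite omE mulr0 add0r mulr1 andbT => fn0; apply/mem_set.
    by apply: contrapT => /(fL n x) /eqP; rewrite (negbTE fn0).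
  by rewrite omE !mulr0 addr0 eqxx.
- move=> x Lx; rewrite -(foo x Lx); apply: eq_eseriesr => n _; congr EFin.
  by rewrite omE /= mulr0 addr0 mulr1 opprB addrC subrK.
Qed.

End CloudProducts.

Theorem corollary5p2 (R : realType) (X : countType) (X0 : inhabited X)
    (alpha : X -> X -> R) (alpha_ge0 : forall x y, (0 <= alpha x y)%R)
    (L : set X) (c w : X -> R)
    (c_ge0 : forall x, (0 <= c x)%R) (w_ge0 : forall x, (0 <= w x)%R)
    (fin_cw : \sum_(0 <= k <oo)
        esandwich c
          (emxpow (emxmul (emxmul (eproj L) (emx_of alpha)) (eproj L)) k) w
      < +oo) :
  (forall f : nat -> X -> R,
    (forall n x, (0 <= f n x <= 1)%R) ->
    (forall n x, ~ L x -> f n x = 0%R) ->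
    (forall x, L x -> \sum_(0 <= n <oo) (f n x)%:E = +oo) ->
    esandwich c
        (emxmul (emxprod (fun i => cleaning alpha (f i)) n) (eproj L)) w
      @[n --> \oo] --> 0)
  /\
  (forall omega : nat -> marker X -> R,
    (forall n eta, (0 <= omega n eta)%R) ->
    (forall n, carried_by (omega n) L) ->
    (forall n, cloud_norm (omega n) <= 1) ->
    (forall x, L x -> \sum_(0 <= n <oo) (1 - omega n (x, [::]))%:E = +oo) ->
    esandwich c
        (emxmul (emxprod (fun i => cloudmx alpha (omega i)) n) (eproj L)) w
      @[n --> \oo] --> 0).
Proof.
split=> [f f01 fL foo|omega om0 omL om1 omoo].
  exact: (cleaning_product_cvg0 alpha L c w).
apply: (cloud_product_cvg0 alpha L c w) => // n.
- exact: cloud_norm_path_sum.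
- exact: carried_by_in.
Qed.
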